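(* Let $K$ be an algebraically closed field of characteristic $0$, let $m,n$ be positive integers, and let $\omega\in K$ be a primitive $m$-th root of unity. Suppose that $A=(A(i,j))_{1\le i,j\le n}$ is an $mn$-by-$mn$ matrix over $K$ partitioned into $n^2$ circulant blocks of size $m$-by-$m$, where for $1\le i,j\le n$, $A(i,j)=circ(a(i,j))$ with $a(i,j)=(a_0(i,j),a_1(i,j),\ldots,a_{m-1}(i,j))^T$, $a_k(i,j)\in K$ for $k=0,1,\ldots,m-1$. For $k=0,1,\ldots,m-1$ let $\mathbf{e}_k^T=(1,\omega^k,\omega^{2k},\ldots,\omega^{(m-1)k})$ and let $S_k=(s_k(i,j))_{1\le i,j\le n}$ be the $n$-by-$n$ matrix with $s_k(i,j)=\mathbf{e}_k^T a(i,j)$. Then $$\sigma(A)=\bigcup_{k=0}^{m-1}\sigma(S_k).$$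
   Context: $circ(a_0,\ldots,a_{m-1})$ denotes the $m$-by-$m$ circulant matrix with first row $(a_0,\ldots,a_{m-1})$ in which each row is the cyclic shift to the right by one position of the row above. $\sigma(M)$ denotes the set of eigenvalues of a square matrix $M$. *)

(* Defs.v *)
From mathcomp Require Import all_boot all_order all_algebra.
From mathcomp Require Import boolp classical_sets.

Set Implicit Arguments.
Unset Strict Implicit.
Unset Printing Implicit Defensive.

Import GRing.Theory.
Local Open Scope ring_scope.
Local Open Scope classical_set_scope.

(* Row [i] is the first row [a^T] shifted cyclically [i] times to the right:
   its entry in column [j] is [a] at index [j - i] modulo [m]. *)
Definition circ (K : fieldType) (m : nat) (a : 'cV[K]_m) : 'M[K]_m :=
  \matrix_(i, j) a (iter i (@ord_pred m) j) 0.

(* [eigenvalue] is defined through row eigenvectors [v *m M = x *: v]; for a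
   square matrix over a field this gives the same set as column eigenvectors. *)
Definition spectrum (K : fieldType) (n : nat) (M : 'M[K]_n) : set K :=
  [set x | eigenvalue M x].

Definition evec (K : fieldType) (m : nat) (omega : K) (k : nat) : 'cV[K]_m :=
  \col_(l < m) omega ^+ (l * k).

Definition Smx (K : fieldType) (m n : nat) (omega : K)
    (a : 'I_n -> 'I_n -> 'cV[K]_m) (k : nat) : 'M[K]_n :=
  \matrix_(i, j) ((evec m omega k)^T *m a i j) 0 0.

(* Main.v *)
Require Import Defs.
From mathcomp Require Import all_boot all_order all_algebra.
From mathcomp Require Import boolp classical_sets.

Set Implicit Arguments.
Unset Strict Implicit.
Unset Printing Implicit Defensive.

Import GRing.Theory.
Local Open Scope ring_scope.
Local Open Scope classical_set_scope.

(* The Fourier matrix with columns e_0, ..., e_(m-1) is invertible and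
   simultaneously diagonalizes all circulant matrices: each e_k is a column
   eigenvector of circ(c) for the eigenvalue e_k^T c. Applying this change of
   coordinates to every block of a row vector v turns the equation v A = x v
   into the m independent systems u_k S_k = x u_k, where u_k collects the k-th
   Fourier coordinates of the blocks of v. So x is an eigenvalue of A if and
   only if some u_k can be chosen nonzero. *)

Lemma iter_ord_predK m i : cancel (iter i (@ordS m)) (iter i (@ord_pred m)).
Proof. by elim: i => // i IHi j; rewrite iterSr iterS ordSK IHi. Qed.

Lemma expr_iter_ordS (R : nzRingType) (m : nat) (z : R) (i : nat) (j : 'I_m) :
  z ^+ m = 1 -> z ^+ iter i (@ordS m) j = z ^+ (i + j).
Proof.
by move=> zm1; elim: i => // i IHi; rewrite iterS /= expr_mod // exprS IHi -exprS.
Qed.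

Lemma prim_root_expr_inj (R : nzRingType) (m : nat) (z : R) :
  m.-primitive_root z -> injective (fun k : 'I_m => z ^+ k).
Proof.
move=> prim_z i j /eqP; rewrite (eq_prim_root_expr prim_z) !modn_small //.
by move/eqP/val_inj.
Qed.

Lemma Vandermonde_unitmx (F : fieldType) (n : nat) (a : 'rV[F]_n) :
  injective (a 0) -> Vandermonde n a \in unitmx.
Proof.
move=> a_inj; rewrite unitmxE det_Vandermonde unitfE.
apply/prodf_neq0 => i _; apply/prodf_neq0 => j lt_ij.
by rewrite subr_eq0; apply: contraTneq lt_ij => /a_inj->; rewrite ltnn.
Qed.

(** The Vandermonde form, with nodes 1, omega, ..., omega^(m-1), reduces invertibility to the
    distinctness of these powers. *)
Definition fourier_mx (K : fieldType) (m : nat) (omega : K) : 'M[K]_m :=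
  Vandermonde m (\row_(k < m) omega ^+ k).

Lemma fourier_unitmx (K : fieldType) (m : nat) (omega : K) :
  m.-primitive_root omega -> fourier_mx m omega \in unitmx.
Proof.
move=> prim_omega; apply: Vandermonde_unitmx => i j; rewrite !mxE.
exact: prim_root_expr_inj.
Qed.

Lemma circ_fourier (K : fieldType) (m : nat) (omega : K) (c : 'cV[K]_m) :
  omega ^+ m = 1 ->
  circ c *m fourier_mx m omega =
  fourier_mx m omega *m diag_mx (\row_k ((evec m omega k)^T *m c) 0 0).
Proof.
move=> omega_m; apply/matrixP => i k; rewrite mul_mx_diag !mxE.
(* Substituting j = i + l mod m undoes the shift of row i; since omega^m = 1, the factor omega^(ik)
   then comes out of the sum. *)
rewrite (reindex_inj (can_inj (@iter_ord_predK m i))) mulr_sumr.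
apply: eq_bigr => l _; rewrite !mxE iter_ord_predK.
rewrite [X in c l 0 * X]exprAC (expr_iter_ordS i l omega_m) exprD exprMn.
by rewrite exprM mulrC [omega ^+ k ^+ i]exprAC mulrA.
Qed.

Lemma block_circ_eigenP (K : fieldType) (m n : nat) (omega : K)
    (a : 'I_n -> 'I_n -> 'cV[K]_m) (v : 'I_n -> 'rV[K]_m) (x : K) :
  m.-primitive_root omega ->
  (\mxrow_i v i) *m (\mxblock_(i, j) circ (a i j)) = x *: (\mxrow_i v i) <->
  forall k : 'I_m,
    (\row_i (v i *m fourier_mx m omega) 0 k) *m Smx omega a k =
    x *: \row_i (v i *m fourier_mx m omega) 0 k.
Proof.
move=> prim_omega; set V := fourier_mx m omega.
have V_unit : V \in unitmx by apply: fourier_unitmx.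
have scale_row : x *: (\mxrow_i v i) = \mxrow_i (x *: v i).
  by apply/matrixP => i j; rewrite !mxE.
(* The decoupling: [V] turns each circulant block into a diagonal one, so the k-th coordinate of
   block j of vA involves only the k-th coordinates of the blocks of v, with weights s_k(i,j). *)
have coordE (j : 'I_n) (k : 'I_m) :
    ((\sum_i v i *m circ (a i j)) *m V) 0 k =
    ((\row_i (v i *m V) 0 k) *m Smx omega a k) 0 j.
  rewrite mulmx_suml summxE [RHS]mxE; apply: eq_bigr => i _.
  rewrite -mulmxA circ_fourier ?(prim_expr_order prim_omega) // mulmxA.
  by rewrite mul_mx_diag !mxE.
rewrite mul_mxrow_mxblock scale_row.
split=> [/eq_mxrowP eq_v k | eq_u].
  apply/rowP => j; rewrite -coordE eq_v -scalemxAl.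
  by rewrite !mxE.
(* As [V] is invertible, blocks with equal Fourier coordinates are equal. *)
apply: eq_mxrow => j; apply: (can_inj (mulmxK V_unit)).
apply/rowP => k; rewrite coordE eq_u -scalemxAl.
by rewrite !mxE.
Qed.

Theorem theorem14 (K : closedFieldType) (charK : [pchar K] =i pred0)
    (m n : nat) (m_gt0 : (0 < m)%N) (n_gt0 : (0 < n)%N)
    (omega : K) (omega_prim : m.-primitive_root omega)
    (a : 'I_n -> 'I_n -> 'cV[K]_m)
    (A : 'M[K]_(\sum_(i < n) m))
    (A_blocks : forall i j : 'I_n, submxblock A i j = circ (a i j)) :
  spectrum A = \bigcup_(k < m) spectrum (Smx omega a k).
Proof.
have -> : A = \mxblock_(i, j) circ (a i j).
  by rewrite -[LHS]submxblockK; apply: eq_mxblock.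
have V_unit := fourier_unitmx omega_prim.
apply/seteqP; split=> x /=.
  move=> /eigenvalueP[v]; rewrite -[v]submxrowK.
  move=> /(block_circ_eigenP _ _ _ omega_prim) eq_u v_neq0.
  (* If all u_k vanished, every block of v would be killed by the invertible Fourier matrix, forcing
     v = 0. *)
  suff [k u_neq0] : exists k : 'I_m,
      \row_i (submxrow v i *m fourier_mx m omega) 0 k != 0.
    by exists k => //=; apply/eigenvalueP; exact: (ex_intro2 _ _ _ (eq_u k)).
  apply/existsP; apply: contraNT v_neq0 => /existsPn u_eq0.
  rewrite -(@mxrow0 K n (fun=> m)); apply/eqP/eq_mxrow => i.
  apply: (can_inj (mulmxK V_unit)); apply/rowP => k.
  have /negPn/eqP/rowP/(_ i) := u_eq0 k.
  by rewrite mul0mx !mxE.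
move=> [k lt_km] /eigenvalueP[u eq_u u_neq0].
pose k0 := Ordinal lt_km.
(* Inverse transform of the data equal to u at frequency [k0] and 0 at all others: block i is u_i
   times row [k0] of the inverse Fourier matrix. *)
pose v i : 'rV[K]_m := u 0 i *: delta_mx 0 k0 *m invmx (fourier_mx m omega).
have coordE l : \row_i (v i *m fourier_mx m omega) 0 l = (l == k0)%:R *: u.
  by apply/rowP => i; rewrite mxE /v mulmxKV // !mxE eqxx /= mulrC.
apply/eigenvalueP; exists (\mxrow_i v i).
  apply/(block_circ_eigenP _ _ _ omega_prim) => l; rewrite coordE.
  case: eqP => [->|_]; last by rewrite !scale0r mul0mx scaler0.
  by rewrite scale1r.
apply: contraNneq u_neq0; rewrite -(@mxrow0 K n (fun=> m)) => /eq_mxrowP v_eq0.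
(* Writing u as [(k0 == k0)%:R *: u] lets [coordE] recover it from v, so v = 0 would give u = 0. *)
rewrite -[u]scale1r -[1]/((true : bool)%:R) -[true](eqxx k0) -coordE.
by apply/eqP/rowP => i; rewrite mxE v_eq0 mul0mx !mxE.
Qed.
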